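(* Let $p:S\to X$ be an unbranched geometrically characteristic covering map between connected surfaces without boundary, let $P\subset X$ be a closed and discrete set of marked points, let $\widetilde P=p^{-1}(P)$, and suppose that $S$ is a surface of infinite type or of finite type with negative Euler characteristic. If the short exact sequence $$1\to\mathrm{Deck}(p)\to\mathrm{SMap}(S;\widetilde P)\to\mathrm{LMap}(X;P)\to1$$ splits, then there is an injective homomorphism $$\mathrm{Map}(X;P)\to\mathrm{Map}(S;\widetilde P)$$ obtained by lifting mapping classes.
   Context: A topological surface (orientable or not) is of finite type if its fundamental group is finitely generated, and of infinite type otherwise. For a connected surface $\Sigma$ without boundary and a closed discrete subset $B$, $\mathrm{Homeo}(\Sigma;B)$ is the group of homeomorphisms of $\Sigma$ that preserve $B$ as a set, required to be orientation-preserving when $\Sigma$ is orientable. $\mathrm{Map}(\Sigma;B)$ is the group of isotopy classes of elements of $\mathrm{Homeo}(\Sigma;B)$, isotopies being required to preserve $B$. Geometrically characteristic cover: an automorphism of $\pi_1(\Sigma,x)$ is geometric if it is induced by a homeomorphism of $\Sigma$ that preserves $x$. A subgroup of $\pi_1(\Sigma,x)$ is geometrically characteristic if it is invariant under all geometric automorphisms. An unbranched covering map $p:S\to X$ (a covering map in the usual sense, possibly with infinitely many sheets) is geometrically characteristic if it corresponds to a geometrically characteristic subgroup of $\pi_1(X,x)$. $\mathrm{Deck}(p)$ is the deck transformation group. A homeomorphism $f$ of $S$ is fiber-preserving if for each $x\in X$ there is $y\in X$ with $f(p^{-1}(x))=p^{-1}(y)$; it then induces a homeomorphism $\bar f$ of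 $X$ with $\bar f\circ p=p\circ f$. A homeomorphism of $X$ is liftable if it is of the form $\bar f$ for some fiber-preserving $f$. $\mathrm{SMap}(S;\widetilde P)$ is the group of mapping classes in $\mathrm{Map}(S;\widetilde P)$ represented by fiber-preserving homeomorphisms of $S$ (preserving $\widetilde P$), and $\mathrm{LMap}(X;P)$ is the group of mapping classes in $\mathrm{Map}(X;P)$ represented by liftable homeomorphisms preserving $P$. In the exact sequence, the first map sends a deck transformation to its mapping class and the second sends $[f]$ to $[\bar f]$; under the hypotheses the sequence is a well-defined short exact sequence because $p:S\setminus\widetilde P\to X\setminus P$ has the Birman--Hilden property (every fiber-preserving homeomorphism isotopic to the identity is isotopic to it through fiber-preserving homeomorphisms). *)

(* Defs.v *)
From HB Require Import structures.
From mathcomp Require Import all_boot all_order all_algebra.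
From mathcomp Require Import generic_quotient freeg.
From mathcomp Require Import all_classical all_reals topology normedtype.

Set Implicit Arguments.
Unset Strict Implicit.
Unset Printing Implicit Defensive.

Import Order.TTheory GRing.Theory Num.Theory.
Import numFieldNormedType.Exports.

Local Open Scope classical_set_scope.
Local Open Scope ring_scope.
Local Open Scope quotient_scope.

Definition homeo_on (T U : topologicalType) (A : set T) (B : set U)
    (f : T -> U) : Prop :=
  exists g : U -> T,
    [/\ {within A, continuous f}, {within B, continuous g},
        f @` A = B, g @` B = A & forall x, A x -> g (f x) = x].

(* The charts are onto open subsets of the plane, so there is no boundary. *)
Definition connected_surface (R : realType) (X : topologicalType) : Prop :=
  [/\ [set: X] !=set0, connected [set: X], hausdorff_space X,
      @second_countable X &
      forall x : X, exists (U : set X) (V : set 'rV[R]_2) (phi : X -> 'rV[R]_2),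
        [/\ open U, U x, open V & homeo_on U V phi]].

Definition covering_map (S X : topologicalType) (p : S -> X) : Prop :=
  continuous p /\
  forall x : X, exists (U : set X) (sheets : set (set S)),
    [/\ open U /\ U x, sheets !=set0,
        forall V, sheets V -> open V /\ homeo_on V U p,
        trivIset sheets id & \bigcup_(V in sheets) V = p @^-1` U].

Definition closed_discrete (X : topologicalType) (P : set X) : Prop :=
  closed P /\ isolated P = P.

Definition homeomorphism (X : topologicalType) (f : X -> X) : Prop :=
  exists g : X -> X, [/\ continuous f, continuous g, cancel f g & cancel g f].

Record Homeo (X : topologicalType) := MkHomeo {
  homeo_fun :> X -> X;
  _ : `[< homeomorphism homeo_fun >] }.

HB.instance Definition _ (X : topologicalType) := [isSub for @homeo_fun X].
HB.instance Definition _ (X : topologicalType) := [Choice of Homeo X by <:].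

Section HomeoGroup.
Context (X : topologicalType).
Implicit Types f g h : Homeo X.

Lemma homeoP f : homeomorphism f.
Proof. by case: f => f /= /asboolP. Qed.

Lemma homeo_continuous f : continuous f.
Proof. by case: (homeoP f) => ? []. Qed.

Lemma homeo_ext f g : f =1 g -> f = g.
Proof. by move=> fg; apply/val_inj/funext. Qed.

Lemma homeo_id_subproof : `[< @homeomorphism X idfun >].
Proof. by apply/asboolP; exists idfun; split=> // x A. Qed.

Definition homeo_id : Homeo X := MkHomeo homeo_id_subproof.

Lemma homeo_comp_subproof f g : `[< homeomorphism (f \o g) >].
Proof.
apply/asboolP; have [f' [cf cf' fK f'K]] := homeoP f.
have [g' [cg cg' gK g'K]] := homeoP g.
exists (g' \o f'); split.
- by move=> x; apply: continuous_comp; [exact: cg|exact: cf].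
- by move=> x; apply: continuous_comp; [exact: cf'|exact: cg'].
- exact: can_comp.
- exact: can_comp.
Qed.

Definition homeo_comp f g : Homeo X := MkHomeo (homeo_comp_subproof f g).

Definition homeo_inv_fun f : X -> X := sval (cid (homeoP f)).

Lemma homeo_inv_subproof f : `[< homeomorphism (homeo_inv_fun f) >].
Proof.
apply/asboolP; rewrite /homeo_inv_fun; case: cid => g [? ? ? ?].
by exists f.
Qed.

Definition homeo_inv f : Homeo X := MkHomeo (homeo_inv_subproof f).

Lemma homeo_invK f : cancel f (homeo_inv f).
Proof. by rewrite /= /homeo_inv_fun; case: cid => g []. Qed.

Lemma homeo_Kinv f : cancel (homeo_inv f) f.
Proof. by rewrite /= /homeo_inv_fun; case: cid => g []. Qed.

Lemma homeo_compA : associative homeo_comp.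
Proof. by move=> f g h; exact: homeo_ext. Qed.
Lemma homeo_comp1f : left_id homeo_id homeo_comp.
Proof. by move=> f; exact: homeo_ext. Qed.
Lemma homeo_compf1 : right_id homeo_id homeo_comp.
Proof. by move=> f; exact: homeo_ext. Qed.
Lemma homeo_compVf : left_inverse homeo_id homeo_inv homeo_comp.
Proof. by move=> f; apply: homeo_ext => x; exact: homeo_invK. Qed.
Lemma homeo_compfV : right_inverse homeo_id homeo_inv homeo_comp.
Proof. by move=> f; apply: homeo_ext => x; exact: homeo_Kinv. Qed.

HB.instance Definition _ := isGroup.Build (Homeo X)
  homeo_compA homeo_comp1f homeo_compf1 homeo_compVf homeo_compfV.

Lemma homeo1E x : (1%g : Homeo X) x = x. Proof. by []. Qed.
Lemma homeoME f g x : (f * g)%g x = f (g x). Proof. by []. Qed.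
Lemma homeoK f : cancel f (f^-1)%g. Proof. exact: homeo_invK. Qed.
Lemma homeoKV f : cancel (f^-1)%g f. Proof. exact: homeo_Kinv. Qed.

HB.instance Definition _ f := isContinuous.Build X X f (@homeo_continuous f).

End HomeoGroup.

Section FundamentalGroup.
Context (R : realType) (X : topologicalType).
Local Notation I := (`[0 : R, 1]%classic).

Definition loop (x : X) : set (R -> X) :=
  [set c | [/\ {within I, continuous c}, c 0 = x & c 1 = x]].

Definition path_homotopic (c d : R -> X) : Prop :=
  exists H : R * R -> X,
    [/\ {within I `*` I, continuous H},
        forall t, I t -> H (0, t) = c t /\ H (1, t) = d t &
        forall s, I s -> H (s, 0) = c 0 /\ H (s, 1) = c 1].

Definition path_cat (c d : R -> X) : R -> X :=
  fun t => if t <= 2^-1 then c (2 * t) else d (2 * t - 1).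

Definition path_rev (c : R -> X) : R -> X := fun t => c (1 - t).

(* A subgroup of the fundamental group at [x] is represented by the set of
   all loops whose class it contains. *)
Definition pi1_subgroup (x : X) (H : set (R -> X)) : Prop :=
  [/\ H `<=` loop x,
      forall c d, H c -> loop x d -> path_homotopic c d -> H d,
      H (cst x),
      forall c d, H c -> H d -> H (path_cat c d) &
      forall c, H c -> H (path_rev c)].

Definition pi1_finitely_generated (x : X) : Prop :=
  exists G : set (R -> X), [/\ finite_set G, G `<=` loop x &
    forall H, pi1_subgroup x H -> G `<=` H -> H = loop x].

Definition finite_type : Prop := forall x : X, pi1_finitely_generated x.

Definition infinite_type : Prop := ~ finite_type.

End FundamentalGroup.

Section GeometricallyCharacteristic.
Context (R : realType) (S X : topologicalType) (p : S -> X).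

(* the subgroup of the fundamental group at [p s] to which [p] corresponds *)
Definition pi1_image (s : S) : set (R -> X) :=
  [set c | loop (p s) c /\
           exists2 d, loop s d & path_homotopic (p \o d) c].

(* A homeomorphism [f] of [X] fixing [x] induces [c] |-> [f \o c] on the
   fundamental group at [x]. *)
Definition invariant_under_geometric_automorphisms (x : X)
    (H : set (R -> X)) : Prop :=
  forall f : Homeo X, f x = x -> forall c, H c -> H (f \o c).

Definition geometrically_characteristic : Prop :=
  exists s : S, invariant_under_geometric_automorphisms (p s) (pi1_image s).

End GeometricallyCharacteristic.

Definition stdsimplex (R : realType) (n : nat) : set 'rV[R]_n.+1 :=
  [set v | (forall i, 0 <= v ord0 i) /\ \sum_i v ord0 i = 1].

Arguments stdsimplex : clear implicits.

Notation singular_simplex R n X := (continuousType (stdsimplex R n) X).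

Notation singular_chain R n X := {freeg (singular_simplex R n X) / int}.

Section Face.
Context (R : realType) (n : nat) (i : 'I_n.+2).

(* the [i]-th coordinate is 0 *)
Definition face_coord (v : 'rV[R]_n.+1) : 'rV[R]_n.+2 :=
  \row_j (if unlift i j is Some k then v ord0 k else 0).

Lemma face_coord_continuous : continuous face_coord.
Proof.
move=> v U [P Pv PU].
have Pj j : nbhs v [set w | P ord0 j (face_coord w ord0 j)].
  have := Pv ord0 j; rewrite mxE.
  case Dj: (unlift i j) => [k|] Pj; last first.
    by apply: filterE => w /=; rewrite mxE Dj; exact: nbhs_singleton Pj.
  have Pk : nbhs v [set w : 'rV[R]_n.+1 | P ord0 j (w ord0 k)].
    exact: (@coord_continuous R 1 n.+1 ord0 k v _ Pj).
  by apply: filterS Pk => w /=; rewrite mxE Dj.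
have Pface : nbhs v [set w | forall j, P ord0 j (face_coord w ord0 j)].
  exact: filter_forall Pj.
apply: filterS Pface => w /= Pw; apply: PU => a j.
by rewrite (ord1 a); exact: Pw.
Qed.

Lemma face_subproof (v : stdsimplex R n) :
  face_coord (set_val v) \in stdsimplex R n.+1.
Proof.
have [v0 v1] := set_valP v; apply/mem_set; split=> [j|].
  by rewrite mxE; case: unlift.
rewrite (bigD1_ord i) //= mxE unlift_none add0r -[RHS]v1.
by apply: eq_bigr => j _; rewrite mxE liftK.
Qed.

Definition face (v : stdsimplex R n) : stdsimplex R n.+1 :=
  exist _ (face_coord (set_val v)) (face_subproof v).

Lemma face_continuous : continuous face.
Proof.
apply: continuous_comp_initial => v.
apply: (@continuous_comp _ _ _ (set_val : stdsimplex R n -> _) face_coord).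
  exact: initial_continuous.
exact: face_coord_continuous.
Qed.

HB.instance Definition _ := isContinuous.Build _ _ face face_continuous.

End Face.

Section SingularHomology.
Context (R : realType) (X : topologicalType).

Definition boundary n : singular_chain R n.+1 X -> singular_chain R n X :=
  fglift (fun s : singular_simplex R n.+1 X =>
    \sum_(i < n.+2) (-1) ^+ i *: << (s \o face i : singular_simplex R n X) >>).

Definition chain_in n (A : set X) (c : singular_chain R n X) : Prop :=
  forall s : singular_simplex R n X, s \in dom c -> range s `<=` A.

Definition is_cycle n : singular_chain R n X -> Prop :=
  if n is m.+1 then fun c => boundary c = 0 else fun=> True.

Definition is_boundary n (c : singular_chain R n X) : Prop :=
  exists b : singular_chain R n.+1 X, c = boundary b.

(* [k] cycles whose classes are linearly independent in the [n]-th homology *)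
Definition independent_cycles n k (z : 'I_k -> singular_chain R n X) : Prop :=
  (forall i, is_cycle (z i)) /\
  forall a : 'I_k -> int, is_boundary (\sum_i a i *: z i) ->
    forall i, a i = 0.

(* the [n]-th homology group has rank [b] *)
Definition betti_number n b : Prop :=
  (exists z : 'I_b -> singular_chain R n X, independent_cycles z) /\
  ~ (exists z : 'I_b.+1 -> singular_chain R n X, independent_cycles z).

Definition euler_characteristic (e : int) : Prop :=
  exists (N : nat) (b : nat -> nat),
    [/\ forall n, betti_number n (b n),
        forall n, (N <= n)%N -> b n = 0%N &
        e = \sum_(n < N) (-1) ^+ n * (b n)%:Z].

(* chains are taken modulo those in [A], as in the homology of [(X, A)] *)
Definition relative_cycle n (A : set X) (c : singular_chain R n.+1 X) : Prop :=
  chain_in A (boundary c).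

Definition relative_homologous n (A : set X) (c d : singular_chain R n X)
  : Prop :=
  exists b : singular_chain R n.+1 X, chain_in A (c - d - boundary b).

(* [c] represents a generator of the second homology of [(X, X \ x)] *)
Definition local_orientation (x : X) (c : singular_chain R 2 X) : Prop :=
  relative_cycle (~` [set x]) c /\
  forall d : singular_chain R 2 X, relative_cycle (~` [set x]) d ->
    exists k : int, relative_homologous (~` [set x]) d (k *: c).

(* Each local orientation is given by a relative cycle; near every point they
   are all induced by a class of the homology of [(X, X \ U)]. *)
Definition is_orientation (o : X -> singular_chain R 2 X) : Prop :=
  (forall x, local_orientation x (o x)) /\
  forall x, exists (U : set X) (c : singular_chain R 2 X),
    [/\ open U, U x, relative_cycle (~` U) c &
        forall y, U y -> relative_homologous (~` [set y]) c (o y)].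

Definition pushforward n (f : Homeo X) :
    singular_chain R n X -> singular_chain R n X :=
  fglift (fun s : singular_simplex R n X =>
    << (f \o s : singular_simplex R n X) >>).

(* No condition when [X] is not orientable; when [X] is a connected orientable
   surface, the condition for one orientation implies it for the other. *)
Definition orientation_preserving (f : Homeo X) : Prop :=
  forall o, is_orientation o ->
    forall x, relative_homologous (~` [set f x]) (pushforward f (o x)) (o (f x)).

End SingularHomology.
Section Pushforward.
Context (R : realType) (X : topologicalType).
Local Notation chain n := (singular_chain R n X).

Lemma chain_additive_ext (K : choiceType) (M : zmodType)
    (u v : {additive {freeg K / int} -> M}) :
  (forall s, u << s >> = v << s >>) -> u =1 v.
Proof.
move=> uv c; rewrite -[c]freeg_sumE !raddf_sum; apply: eq_bigr => s _.
by rewrite -[coeff s c]intz -freegU_mulz !raddfMz uv.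
Qed.

HB.instance Definition _ n := GRing.isZmodMorphism.Build _ _ (@boundary R X n)
  (lift_is_additive _).

HB.instance Definition _ n f := GRing.isZmodMorphism.Build _ _
  (@pushforward R X n f) (lift_is_additive _).

Lemma pushforward_simplex n f (s : singular_simplex R n X) :
  pushforward f << s >> = << (f \o s : singular_simplex R n X) >>.
Proof. by rewrite /pushforward liftU scale1r. Qed.

Lemma boundary_simplex n (s : singular_simplex R n.+1 X) :
  boundary << s >> =
  \sum_(i < n.+2) (-1) ^+ i *: << (s \o face i : singular_simplex R n X) >>.
Proof. by rewrite /boundary liftU scale1r. Qed.

Lemma pushforward_boundary n f (c : chain n.+1) :
  pushforward f (boundary c) = boundary (pushforward f c).
Proof.
move: c; apply: (@chain_additive_ext _ _
  (pushforward f \o @boundary R X n) (@boundary R X n \o pushforward f)) => s /=.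
rewrite pushforward_simplex !boundary_simplex raddf_sum; apply: eq_bigr => i _.
rewrite raddfZsign /= pushforward_simplex; congr (_ *: << _ >>).
exact/continuousEP.
Qed.

Lemma pushforward1 n (c : chain n) : pushforward 1%g c = c.
Proof.
move: c; apply: (@chain_additive_ext _ _ (pushforward 1%g) idfun) => s /=.
by rewrite pushforward_simplex; congr << _ >>; exact/continuousEP.
Qed.

Lemma pushforwardM n f g (c : chain n) :
  pushforward (f * g)%g c = pushforward f (pushforward g c).
Proof.
move: c; apply: (@chain_additive_ext _ _
  (pushforward (f * g)%g) (pushforward f \o pushforward g)) => s /=.
by rewrite !pushforward_simplex; congr << _ >>; exact/continuousEP.
Qed.

Lemma chain_inD n (A : set X) (c d : chain n) :
  chain_in A c -> chain_in A d -> chain_in A (c + d).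
Proof. by move=> cA dA s /domD_subset; rewrite mem_cat => /orP[/cA|/dA]. Qed.

Lemma chain_inN n (A : set X) (c : chain n) : chain_in A c -> chain_in A (- c).
Proof. by move=> cA s; rewrite domN => /cA. Qed.

Lemma chain_in_pushforward n (f : Homeo X) (A B : set X) (c : chain n) :
  (forall x, A x -> B (f x)) -> chain_in A c -> chain_in B (pushforward f c).
Proof.
move=> AB cA s; rewrite -[X in pushforward _ X]freeg_sumE raddf_sum.
move=> /dom_sum_subset /flattenP[/= l /mapP[t]]; rewrite filter_predT => tc ->.
rewrite /pushforward liftU => /domZ_subset; rewrite domU1 inE => /eqP ->.
by move=> _ [v _ <-] /=; apply: AB; apply: cA tc _ _; exists v.
Qed.

Lemma relative_homologous_refl n (A : set X) (c : chain n) :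
  relative_homologous A c c.
Proof. by exists 0 => s; rewrite subrr raddf0 subr0 dom0. Qed.

Lemma relative_homologous_sym n (A : set X) (c d : chain n) :
  relative_homologous A c d -> relative_homologous A d c.
Proof.
move=> [b cdb]; exists (- b); rewrite raddfN.
have -> : d - c - - boundary b = - (c - d - boundary b).
  by rewrite !opprB opprK addrC.
exact: chain_inN.
Qed.

Lemma relative_homologous_trans n (A : set X) (c d e : chain n) :
  relative_homologous A c d -> relative_homologous A d e ->
  relative_homologous A c e.
Proof.
move=> [b cdb] [b' deb]; exists (b + b'); rewrite raddfD.
have -> : c - e - (boundary b + boundary b') =
    (c - d - boundary b) + (d - e - boundary b').
  by rewrite [RHS]addrACA -opprD; congr (_ - _); rewrite addrA subrK.
exact: chain_inD.
Qed.

Lemma relative_homologous_pushforward n (f : Homeo X) (x : X) (c d : chain n) :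
  relative_homologous (~` [set x]) c d ->
  relative_homologous (~` [set f x]) (pushforward f c) (pushforward f d).
Proof.
move=> [b cdb]; exists (pushforward f b).
rewrite -pushforward_boundary -!raddfB; apply: chain_in_pushforward cdb.
by move=> y yx /(can_inj (homeoK f)).
Qed.

Lemma orientation_preserving1 : orientation_preserving R (1%g : Homeo X).
Proof.
by move=> o _ x; rewrite pushforward1; exact: relative_homologous_refl.
Qed.

Lemma orientation_preservingM (f g : Homeo X) :
  orientation_preserving R f -> orientation_preserving R g ->
  orientation_preserving R (f * g)%g.
Proof.
move=> fo go o oo x; rewrite pushforwardM homeoME.
apply: relative_homologous_trans (fo o oo (g x)).
exact/relative_homologous_pushforward/go.
Qed.

Lemma orientation_preservingV (f : Homeo X) :
  orientation_preserving R f -> orientation_preserving R (f^-1)%g.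
Proof.
move=> fo o oo y; have := fo o oo (f^-1%g y); rewrite homeoKV.
move=> /(@relative_homologous_pushforward _ f^-1%g).
rewrite -pushforwardM mulVg pushforward1.
exact: relative_homologous_sym.
Qed.

End Pushforward.

Section MarkedHomeo.
Context (R : realType) (X : topologicalType) (B : set X).

Definition marked_homeo_pred : {pred Homeo X} :=
  fun f => `[< f @` B = B /\ orientation_preserving R f >].

Lemma marked_homeo_closed : group_closed marked_homeo_pred.
Proof.
split.
  by apply/asboolP; split; [exact: image_id|exact: orientation_preserving1].
move=> f g /asboolP[fB fo] /asboolP[gB go]; apply/asboolP; split.
  rewrite -[X in _ @` X]gB image_comp -[RHS]fB; congr (_ @` B).
  by apply/funext => x; exact: (congr1 f (homeoK g x)).
exact/orientation_preservingM/orientation_preservingV.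
Qed.

Record MHomeo := MkMHomeo {
  mhomeo_val :> Homeo X;
  _ : mhomeo_val \in marked_homeo_pred }.

HB.instance Definition _ := [isSub for mhomeo_val].
HB.instance Definition _ := [Choice of MHomeo by <:].
HB.instance Definition _ :=
  SubChoice_isSubGroup.Build _ _ MHomeo marked_homeo_closed.

End MarkedHomeo.

Section MappingClassGroup.
Context (R : realType) (X : topologicalType) (B : set X).
Local Notation I := (`[0 : R, 1]%classic).
Implicit Types f g h : MHomeo R B.

(* [H (t, _)], for [t] in the unit interval, is a family of homeomorphisms
   preserving [B]; the inverses form the jointly continuous family [K] *)
Definition isotopy_pair (H K : R * X -> X) : Prop :=
  [/\ {within I `*` setT, continuous H}, {within I `*` setT, continuous K} &
      forall t, I t ->
        [/\ forall x, K (t, H (t, x)) = x, forall x, H (t, K (t, x)) = x &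
            [set H (t, x) | x in B] = B]].

Definition isotopic f g : Prop :=
  exists H K, [/\ isotopy_pair H K,
    forall x, H (0, x) = f x & forall x, H (1, x) = g x].

Lemma isotopy_comp_continuous (H H' : R * X -> X) :
  {within I `*` setT, continuous H} -> {within I `*` setT, continuous H'} ->
  {within I `*` setT, continuous (fun z => H (z.1, H' z))}.
Proof.
move=> /subspace_continuousP cH /subspace_continuousP cH'.
apply/subspace_continuousP => -[t x] txI W HW.
have tI : (I `*` [set: X]) (t, H' (t, x)) by case: txI.
have cHW := cH _ tI W HW.
have c1 : (fun z : R * X => z.1) @ within (I `*` setT) (nbhs (t, x)) -->
    nbhs t.
  by apply: cvg_within_filter; exact: cvg_fst.
have c2 : H' @ within (I `*` setT) (nbhs (t, x)) --> nbhs (H' (t, x)).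
  exact: cH'.
have cF := @cvg_pair _ _ _ _ _ _ (within_filter _ (nbhs_filter _))
  (nbhs_filter _) (nbhs_filter _) _ _ c1 c2.
have := cF _ cHW; rewrite /= /within /=.
rewrite /fmap /within /nbhs /=.
by apply: filterS => z + zI => /(_ zI); apply; case: zI.
Qed.

Lemma isotopy_pair_const f :
  isotopy_pair (fun z => f z.2) (fun z => (f^-1)%g z.2).
Proof.
have [fB _] : f @` B = B /\ orientation_preserving R f.
  by apply/asboolP; exact: (valP f).
have cont (g : Homeo X) : {within I `*` setT, continuous (fun z => g z.2)}.
  apply: continuous_subspaceT => z.
  apply: (@continuous_comp _ _ _ snd g z); first exact: cvg_snd.
  exact: (@homeo_continuous X g z.2).
split; [exact: cont|exact: cont|].
by move=> t _; split=> // x /=; [exact: homeoK|exact: homeoKV].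
Qed.

Lemma isotopy_pairM H K H' K' : isotopy_pair H K -> isotopy_pair H' K' ->
  isotopy_pair (fun z => H (z.1, H' z)) (fun z => K' (z.1, K z)).
Proof.
move=> [cH cK HK] [cH' cK' HK']; split; [exact: isotopy_comp_continuous..|].
move=> t tI; have [KH HKt HB] := HK t tI; have [KH' HKt' HB'] := HK' t tI.
split=> [x|x|] /=; rewrite ?KH ?HKt' //.
by rewrite -[RHS]HB -[in RHS]HB' image_comp.
Qed.

Lemma isotopy_pairV H K : isotopy_pair H K -> isotopy_pair K H.
Proof.
move=> [cH cK HK]; split=> // t tI; have [KH HKt HB] := HK t tI.
split=> //; rewrite -[X in image X _]HB image_comp.
by apply/seteqP; split=> [_ [x Bx <-] /=|x Bx]; [|exists x]; rewrite /= ?KH.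
Qed.

Lemma isotopy_pair0 H K : isotopy_pair H K -> forall x, K (0, H (0, x)) = x.
Proof.
by move=> [_ _ HK]; have [] : _ := HK 0; rewrite /= ?in_itv /= ?lexx ?ler01.
Qed.

Lemma isotopy_pair1 H K : isotopy_pair H K -> forall x, K (1, H (1, x)) = x.
Proof.
by move=> [_ _ HK]; have [] : _ := HK 1; rewrite /= ?in_itv /= ?lexx ?ler01.
Qed.

Lemma isotopic_refl f : isotopic f f.
Proof.
exists (fun z => f z.2), (fun z => (f^-1)%g z.2).
by split=> //; exact: isotopy_pair_const.
Qed.

Lemma isotopicM f f' g g' : isotopic f f' -> isotopic g g' ->
  isotopic (f * g)%g (f' * g')%g.
Proof.
move=> [H [K [HK H0 H1]]] [H' [K' [HK' H0' H1']]].
exists (fun z => H (z.1, H' z)), (fun z => K' (z.1, K z)).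
by split=> [|x|x]; [exact: isotopy_pairM|rewrite /= H0' H0|rewrite /= H1' H1].
Qed.

Lemma isotopicV f g : isotopic f g -> isotopic (f^-1)%g (g^-1)%g.
Proof.
move=> [H [K [HK H0 H1]]]; exists K, H; split; first exact: isotopy_pairV.
- move=> x; rewrite -[in LHS](homeoKV f x) -H0; exact: isotopy_pair0 HK _.
- move=> x; rewrite -[in LHS](homeoKV g x) -H1; exact: isotopy_pair1 HK _.
Qed.

(* if [H] joins [f] to [g], then [f H^-1 g] joins [g] to [f] *)
Lemma isotopic_sym f g : isotopic f g -> isotopic g f.
Proof.
move=> /isotopicV fg.
have := isotopicM (isotopicM (isotopic_refl f) fg) (isotopic_refl g).
by rewrite mulgV mul1g mulgVK.
Qed.

Lemma isotopic_trans g f h : isotopic f g -> isotopic g h -> isotopic f h.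
Proof.
move=> fg gh; have := isotopicM (isotopicM gh (isotopic_refl g^-1%g)) fg.
by rewrite mulgV mul1g mulgVK.
Qed.

Definition isotopicb : rel (MHomeo R B) := fun f g => `[< isotopic f g >].

Lemma isotopicb_refl : reflexive isotopicb.
Proof. by move=> f; apply/asboolP; exact: isotopic_refl. Qed.
Lemma isotopicb_sym : symmetric isotopicb.
Proof. by move=> f g; apply: asbool_equiv_eq; split; exact: isotopic_sym. Qed.
Lemma isotopicb_trans : transitive isotopicb.
Proof.
move=> g f h /asboolP fg /asboolP gh; apply/asboolP; exact: isotopic_trans gh.
Qed.

Canonical isotopicb_equiv :=
  EquivRel isotopicb isotopicb_refl isotopicb_sym isotopicb_trans.

Definition Map := {eq_quot isotopicb}.
HB.instance Definition _ := Choice.on Map.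
HB.instance Definition _ := EqQuotient.on Map.

Definition mclass (f : MHomeo R B) : Map := \pi_Map f.

Lemma mclassP f g : mclass f = mclass g <-> isotopic f g.
Proof. by split=> [/eqmodP/asboolP|fg]; last exact/eqmodP/asboolP. Qed.

Lemma mclass_ex (c : Map) : exists f, c = mclass f.
Proof. by elim/quotW: c => f; exists f. Qed.

Lemma isotopic_repr f : isotopic (repr (mclass f)) f.
Proof. by apply/mclassP; rewrite /mclass reprK. Qed.

Definition map_one : Map := mclass 1%g.
Definition map_mul (c d : Map) : Map := mclass (repr c * repr d)%g.
Definition map_inv (c : Map) : Map := mclass (repr c)^-1%g.

Lemma map_mulE f g : map_mul (mclass f) (mclass g) = mclass (f * g)%g.
Proof. by apply/mclassP/isotopicM; exact: isotopic_repr. Qed.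

Lemma map_invE f : map_inv (mclass f) = mclass (f^-1)%g.
Proof. by apply/mclassP/isotopicV; exact: isotopic_repr. Qed.

Lemma map_mulA : associative map_mul.
Proof.
move=> c d e; have [f ->] := mclass_ex c; have [g ->] := mclass_ex d.
by have [h ->] := mclass_ex e; rewrite !map_mulE mulgA.
Qed.
Lemma map_mul1c : left_id map_one map_mul.
Proof. by move=> c; have [f ->] := mclass_ex c; rewrite map_mulE mul1g. Qed.
Lemma map_mulc1 : right_id map_one map_mul.
Proof. by move=> c; have [f ->] := mclass_ex c; rewrite map_mulE mulg1. Qed.
Lemma map_mulVc : left_inverse map_one map_inv map_mul.
Proof.
by move=> c; have [f ->] := mclass_ex c; rewrite map_invE map_mulE mulVg.
Qed.
Lemma map_mulcV : right_inverse map_one map_inv map_mul.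
Proof.
by move=> c; have [f ->] := mclass_ex c; rewrite map_invE map_mulE mulgV.
Qed.

HB.instance Definition _ := isGroup.Build Map
  map_mulA map_mul1c map_mulc1 map_mulVc map_mulcV.

Lemma mclass1 : mclass 1%g = 1%g. Proof. by []. Qed.
Lemma mclassM f g : mclass (f * g)%g = (mclass f * mclass g)%g.
Proof. by rewrite -map_mulE. Qed.
Lemma mclassV f : mclass (f^-1)%g = ((mclass f)^-1)%g.
Proof. by rewrite -map_invE. Qed.

End MappingClassGroup.

Section Lifting.
Context (R : realType) (S X : topologicalType) (p : S -> X) (P : set X).

Definition fiber_preserving (f : Homeo S) : Prop :=
  forall x, exists y, f @` (p @^-1` [set x]) = p @^-1` [set y].

Definition induces (f : Homeo S) (h : Homeo X) : Prop :=
  forall s, h (p s) = p (f s).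

Definition liftable (h : Homeo X) : Prop :=
  exists2 f : Homeo S, fiber_preserving f & induces f h.

Lemma fiber_preserving1 : fiber_preserving 1%g.
Proof. by move=> x; exists x; exact: image_id. Qed.

Lemma fiber_preservingM f g :
  fiber_preserving f -> fiber_preserving g -> fiber_preserving (f * g)%g.
Proof.
move=> fp gp x; have [y gxy] := gp x; have [z fyz] := fp y.
by exists z; rewrite -fyz -gxy image_comp.
Qed.

Lemma fiber_preservingV f : fiber_preserving f -> fiber_preserving (f^-1)%g.
Proof.
move=> fp x; have [[s /= ps]|x0] := pselect (exists s, p s = x); last first.
  exists x; apply/seteqP; split => [_ [s /= ps <-]|s /= ps].
    by case: x0; exists s.
  by case: x0; exists s.
have [y fy] := fp (p (f^-1%g s)); exists (p (f^-1%g s)).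
have <- : y = x.
  have : (p @^-1` [set y]) s.
    by rewrite -fy; exists (f^-1%g s) => //; exact: homeoKV.
  by rewrite /= ps.
rewrite -fy image_comp -[RHS]image_id; congr (_ @` _).
by apply/funext => t; exact: homeoK.
Qed.

Lemma induces1 : induces 1%g 1%g. Proof. by []. Qed.

Lemma inducesM f g h k :
  induces f h -> induces g k -> induces (f * g)%g (h * k)%g.
Proof. by move=> fh gk s; rewrite !homeoME gk fh. Qed.

Lemma inducesV f h : induces f h -> induces (f^-1)%g (h^-1)%g.
Proof. by move=> fh s; rewrite -{1}(homeoKV f s) -fh homeoK. Qed.

Definition smap_pred : {pred Map R (p @^-1` P)} :=
  fun c => `[< exists2 f, c = mclass f & fiber_preserving f >].

Lemma smap_closed : group_closed smap_pred.
Proof.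
split; first by apply/asboolP; exists 1%g => //; exact: fiber_preserving1.
move=> _ _ /asboolP[f -> fp] /asboolP[g -> gp]; apply/asboolP.
exists (f / g)%g; first by rewrite mclassM mclassV.
exact/fiber_preservingM/fiber_preservingV.
Qed.

Record SMap := MkSMap {
  smap_val :> Map R (p @^-1` P);
  _ : smap_val \in smap_pred }.
HB.instance Definition _ := [isSub for smap_val].
HB.instance Definition _ := [Choice of SMap by <:].
HB.instance Definition _ := SubChoice_isSubGroup.Build _ _ SMap smap_closed.

Definition lmap_pred : {pred Map R P} :=
  fun c => `[< exists2 h, c = mclass h & liftable h >].

Lemma lmap_closed : group_closed lmap_pred.
Proof.
split.
  apply/asboolP; exists 1%g => //.
  by exists 1%g; [exact: fiber_preserving1|exact: induces1].
move=> _ _ /asboolP[h -> [f fp fh]] /asboolP[k -> [g gp gk]]; apply/asboolP.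
exists (h / k)%g; first by rewrite mclassM mclassV.
exists (f / g)%g; first exact/fiber_preservingM/fiber_preservingV.
exact/inducesM/inducesV.
Qed.

Record LMap := MkLMap {
  lmap_val :> Map R P;
  _ : lmap_val \in lmap_pred }.
HB.instance Definition _ := [isSub for lmap_val].
HB.instance Definition _ := [Choice of LMap by <:].
HB.instance Definition _ := SubChoice_isSubGroup.Build _ _ LMap lmap_closed.

Definition lifts (c : Map R (p @^-1` P)) (d : Map R P) : Prop :=
  exists f h, [/\ c = mclass f, d = mclass h, fiber_preserving f & induces f h].

(* The map SMap(S; p^-1(P)) -> LMap(X; P) of the exact sequence.  Whenever
   [p : S \ p^-1(P) -> X \ P] has the Birman-Hilden property, exactly one [d]
   satisfies [lifts c d], and [xget] returns it; the default is not used. *)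
Definition smap_proj (c : SMap) : LMap := xget 1%g [set d : LMap | lifts c d].

(* The exact sequence 1 -> Deck(p) -> SMap(S; p^-1(P)) -> LMap(X; P) -> 1
   splits when its surjection has a homomorphic section. *)
Definition exact_sequence_splits : Prop :=
  exists s : {multiplicative LMap -> SMap}, cancel s smap_proj.

End Lifting.

(* Main.v *)
(* A mapping class of [X] lifts as soon as one of its representatives does, so
   the splitting is defined on all of Map(X; P) once every homeomorphism [h]
   of [X] is liftable.  The liftable homeomorphisms form a group whose orbits
   are open: pushing a point inside an evenly covered disc lifts sheet by
   sheet.  As [X] is connected, this group is transitive, and composing [h] with
   one of its elements reduces to the case where [h] fixes the base point; then
   [h] lifts by the lifting criterion, since the subgroup of the covering is
   invariant. *)

Require Import Defs.
From HB Require Import structures.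
From mathcomp Require Import all_boot all_order all_algebra.
From mathcomp Require Import all_classical all_reals topology normedtype.
From mathcomp Require Import ring lra.

Import Order.TTheory GRing.Theory Num.Theory.
Import numFieldNormedType.Exports.

Local Open Scope classical_set_scope.
Local Open Scope ring_scope.

(** * Local arguments for connectedness and continuity *)

Section Topology.
Set Implicit Arguments.
Unset Strict Implicit.

(** Membership in [A] is locally constant along [D], so [A] and its complement are both relatively
    open in [D]. This replaces compactness and subdivision arguments everywhere below. *)
Lemma connected_ind {T : topologicalType} (D A : set T) (x0 : T) :
  connected D ->
  (forall x, D x -> exists2 N, nbhs x N &
    forall y z, N y -> N z -> D y -> D z -> A y -> A z) ->
  D x0 -> A x0 -> D `<=` A.
Proof.
move=> Dc loc Dx0 Ax0.
suff E : D `&` A = D by move=> x; rewrite -{1}E => -[].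
apply: Dc.
- by exists x0.
- exists (interior [set z | D z -> A z]); first exact: open_interior.
  apply/seteqP; split=> [x [Dx Ax]|x [Dx /interior_subset/(_ Dx) Ax]] //.
  split=> //; have [N Nx NA] := loc x Dx; apply: filterS (Nx) => z Nz Dz.
  exact: NA (nbhs_singleton Nx) Nz Dx Dz Ax.
- exists (~` interior [set z | D z -> ~ A z]).
    exact/open_closedC/open_interior.
  apply/seteqP; split=> [x [Dx Ax]|x [Dx nAx]]; split=> //.
    by move=> /interior_subset; exact.
  apply: contrapT => nA; apply: nAx; have [N Nx NA] := loc x Dx.
  apply: filterS (Nx) => z Nz Dz Az; apply: nA.
  exact: NA Nz (nbhs_singleton Nx) Dz Dx Az.
Qed.

Lemma continuous_within_comp {T U V : topologicalType} (A : set T) (f : T -> V)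
    (g : U -> T) : {within A, continuous f} -> continuous g ->
  (forall y, A (g y)) -> continuous (f \o g).
Proof.
move=> /subspace_continuousP cf cg Ag y W fW.
have H : nbhs (g y) [set z | A z -> W (f z)] := cf _ (Ag y) _ fW.
have {}H : nbhs y [set z | A (g z) -> W (f (g z))] := cg y _ H.
by apply: filterS H => z; exact.
Qed.

Lemma continuous_near_eq {T U : topologicalType} (f g : T -> U) x :
  (\forall y \near x, g y = f y) -> {for x, continuous f} ->
  {for x, continuous g}.
Proof.
move=> fg cf V; rewrite /= (nbhs_singleton fg) => /cf Vf.
have {}Vf : nbhs x (f @^-1` V) := Vf.
by apply: filterS2 fg Vf => y /= ->.
Qed.

Lemma continuous_pair {T U V : topologicalType} (f : T -> U) (g : T -> V) :
  continuous f -> continuous g -> continuous (fun t => (f t, g t)).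
Proof.
move=> cf cg x A [[P Q] [/= Pf Qg] PQ].
have fP : nbhs x (f @^-1` P) := cf x _ Pf.
have gQ : nbhs x (g @^-1` Q) := cg x _ Qg.
by apply: filterS2 fP gQ => t Pt Qt; exact: PQ.
Qed.

(** The open sets [U] and the complement of [D] cover the space, and [f] is the identity on the
    second one. *)
Lemma continuous_supported {T : topologicalType} (f : T -> T) (U D : set T) :
  open U -> closed D -> D `<=` U -> (forall z, U z -> {for z, continuous f}) ->
  (forall z, ~ D z -> f z = z) -> continuous f.
Proof.
move=> oU cD DU cf fD z; have [Uz|nUz] := pselect (U z); first exact: cf.
apply: (@continuous_near_eq _ _ id); last exact: cvg_id.
have : nbhs z (~` D).
  by apply: open_nbhs_nbhs; split; [exact: closed_openC|move=> /DU].
by apply: filterS => y; exact: fD.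
Qed.

End Topology.

(** * Evenly covered sets and uniqueness of lifts *)

Section Sheets.
Set Implicit Arguments.
Unset Strict Implicit.
Context {S X : topologicalType} (p : S -> X).

(* [W] is evenly covered, and [g s] is the section over [W] whose image is the
   sheet of [s]. *)
Definition sheet_sections (W : set X) (g : S -> X -> S) : Prop :=
  [/\ open W,
      forall s, W (p s) -> g s (p s) = s,
      forall s y, W (p s) -> W y ->
        [/\ p (g s y) = y, g (g s y) = g s & {for y, continuous (g s)}] &
      forall s, W (p s) -> \forall s' \near s, g s' = g s].

Hypothesis cov : covering_map p.

Lemma covering_continuous : continuous p. Proof. by case: cov. Qed.

(** Each point [s] over [U] lies in exactly one sheet [V s], and its section inverts [p] on that
    sheet. Sheets being open and disjoint, [V] is locally constant, hence so is the choice of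
    section. *)
Lemma evenly_covered (x : X) :
  exists W g, W x /\ sheet_sections W g.
Proof.
have [_ /(_ x)[U [sheets [[oU Ux] [V0 sV0] shV triv shU]]]] := cov.
have [s0 _] : (p @` V0) x.
  by have [_ [h [_ _ -> _ _]]] := shV _ sV0.
have /choice[h hP] : forall V, exists h : X -> S, sheets V ->
    [/\ {within U, continuous h}, p @` V = U, h @` U = V &
     forall s, V s -> h (p s) = s].
  move=> V; have [/shV[_ [h [? ? ? ? ?]]]|nV] := pselect (sheets V).
    by exists h.
  (* A default value for sets that are not sheets; the point [s0] exists because there is at least
     one sheet. *)
  by exists (cst s0).
have /choice[V VP] : forall s, exists V, U (p s) -> sheets V /\ V s.
  move=> s; have [Us|nUs] := pselect (U (p s)); last by exists set0.
  have : (p @^-1` U) s by [].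
  by rewrite -shU => -[V shVV Vs]; exists V.
have Veq s s' : U (p s) -> U (p s') -> V s s' -> V s' = V s.
  move=> Us Us' Vss'; have [sV Vs] := VP _ Us; have [sV' Vs'] := VP _ Us'.
  by apply: triv => //; exists s'.
exists U, (fun s => h (V s)); split=> //; split=> //.
- by move=> s Us; have [sV Vs] := VP _ Us; have [_ _ _] := hP _ sV; apply.
- move=> s y Us Uy; have [sV Vs] := VP _ Us; have [ch pV hU hK] := hP _ sV.
  have Vh : V s (h (V s) y) by rewrite -[in X in X _]hU; exists y.
  have ph : p (h (V s) y) = y.
    by have := Uy; rewrite -[in X in X _]pV => -[v Vv <-]; rewrite hK.
  split=> //; first by congr h; apply: Veq; rewrite ?ph.
  by move: ch; rewrite continuous_open_subspace // => /(_ y (mem_set Uy)).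
- move=> s Us; have [sV Vs] := VP _ Us; have [oV _] := shV _ sV.
  have Up : nbhs s (p @^-1` U) by apply: covering_continuous;
      exact: open_nbhs_nbhs.
  have VV : nbhs s (V s) by exact: open_nbhs_nbhs.
  by apply: filterS2 Up VV => s' /= Us' Vs'; congr h; exact: Veq.
Qed.

(** The section [g s] names the sheet of [s] and is locally constant in [s]; a connected set
    therefore cannot change sheets. *)
Lemma sheet_const {T : topologicalType} (C : set T) (f : T -> S) c0 c W g :
  sheet_sections W g -> connected C -> continuous f ->
  (forall c, C c -> W (p (f c))) -> C c0 -> C c -> g (f c) = g (f c0).
Proof.
move=> [_ _ _ gloc] Cc cf fW Cc0; move: c.
apply: (@connected_ind _ C [set c | g (f c) = g (f c0)] c0) => // c Cc'.
exists [set c' | g (f c') = g (f c)]; first exact: cf _ _ (gloc _ (fW _ Cc')).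
by move=> y z /= -> ->.
Qed.

(** Near any parameter each of the two lifts stays in one sheet. If they meet once there, the sheets
    coincide, and a point is determined by its sheet and its projection. *)
Lemma lift_unique {T : topologicalType} (C : set T) (f f' : T -> S) c0 :
  connected C -> continuous f -> continuous f' ->
  (forall c, C c -> p (f c) = p (f' c)) -> C c0 -> f c0 = f' c0 ->
  forall c, C c -> f c = f' c.
Proof.
move=> Cc cf cf' pf Cc0 f0.
apply: (@connected_ind _ C [set c | f c = f' c] c0) => // c Cc'.
have [W [g [Wc [oW gK gW gloc]]]] := evenly_covered (p (f c)).
exists [set z | [/\ W (p (f z)), g (f z) = g (f c) & g (f' z) = g (f' c)]].
  have N1 : nbhs c [set z | W (p (f z))].
    by apply: (cf c (p @^-1` W));
        exact: (covering_continuous (open_nbhs_nbhs _)).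
  have N2 : nbhs c [set z | g (f z) = g (f c)] := cf _ _ (gloc _ Wc).
  have N3 : nbhs c [set z | g (f' z) = g (f' c)].
    have W' : W (p (f' c)) by rewrite -pf.
    exact: cf' _ _ (gloc _ W').
  by move: N1 N2 N3; apply: filterS3 => z; split.
move=> y z [Wy gy gy'] [Wz gz gz'] Cy Cz /= fy.
have gff' : g (f z) = g (f' z) by rewrite gz gz' -gy -gy' fy.
by rewrite -(gK (f z)) // gff' pf // gK // -pf.
Qed.

End Sheets.

(** * Gluing and clamping paths *)

Section Paths.
Set Implicit Arguments.
Unset Strict Implicit.
Context {R : realType}.
Implicit Types a b t : R.

Lemma continuous_glue {T : topologicalType} a (f g : R -> T) :
  continuous f -> continuous g -> f a = g a ->
  continuous (fun t => if t <= a then f t else g t).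
Proof.
move=> cf cg fg t W; case: (ltgtP t a) => [ta|at_|->] /= Wt.
- have Wf : nbhs t (f @^-1` W) := cf _ _ Wt.
  apply: filterS2 (lt_nbhsl ta) Wf => t' /= t'a Wt'.
  by rewrite (ltW t'a).
- have Wg : nbhs t (g @^-1` W) := cg _ _ Wt.
  apply: filterS2 (lt_nbhsr at_) Wg => t' /= at' Wt'.
  by rewrite leNgt at'.
- have Wf : nbhs a (f @^-1` W) := cf _ _ Wt.
  rewrite fg in Wt; have Wg : nbhs a (g @^-1` W) := cg _ _ Wt.
  by apply: filterS2 Wf Wg => t' /= ? ?; case: ifP.
Qed.

(** Retracting the line onto a segment turns paths on the segment into maps continuous on all of
    [R], which avoids subspace topologies. *)
Definition clamp a b t : R := if t <= a then a else if t <= b then t else b.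

Lemma clamp_continuous a b : a <= b -> continuous (clamp a b).
Proof.
move=> ab; apply: continuous_glue; first exact: cst_continuous.
  by apply: continuous_glue => // [?|]; [exact: cvg_id|exact: cst_continuous].
by rewrite ab.
Qed.

Lemma clamp_itv a b t : a <= b -> a <= clamp a b t <= b.
Proof.
move=> ab; rewrite /clamp; case: (leP t a) => [_|/ltW le_at];
    first by rewrite lexx.
by case: (leP t b) => [tb|_]; rewrite ?le_at ?tb ?ab ?lexx.
Qed.

Lemma clamp_id a b t : a <= t -> t <= b -> clamp a b t = t.
Proof.
by move=> le_at tb; rewrite /clamp tb; case: leP => // ta; apply: le_anti;
    rewrite le_at.
Qed.

End Paths.

(** * Lifting paths and homotopies *)

Section Lifts.
Set Implicit Arguments.
Unset Strict Implicit.
Context {R : realType} {S X : topologicalType} (p : S -> X).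
Hypothesis cov : covering_map p.
Local Notation I := (`[0 : R, 1]%classic).

Lemma connected_realT : connected [set: R].
Proof. exact/connected_intervalP. Qed.

Lemma clamp01_I (t : R) : I (clamp 0 1 t).
Proof. by rewrite /= in_itv /= clamp_itv. Qed.

Lemma clamp01_id (t : R) : I t -> clamp 0 1 t = t.
Proof. by rewrite /= in_itv /= => /andP[]; exact: clamp_id. Qed.

Lemma nbhs_ball_preimage {T : topologicalType} (f : R -> T) (W : set T) u :
  continuous f -> open W -> W (f u) ->
  exists2 e : R, 0 < e & forall v, ball u e v -> W (f v).
Proof.
move=> cf oW Wu; have : nbhs u (f @^-1` W) by apply: cf; exact: open_nbhs_nbhs.
by move=> /nbhs_ballP[e /= e0 ue]; exists e.
Qed.

(** The times up to which a lift exists are propagated by [connected_ind]: inside an evenly covered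
    set, a lift up to [y] is prolonged to [z] by the section through its value at [y]. *)
Lemma path_lift (c : R -> X) (s0 : S) : continuous c -> p s0 = c 0 ->
  exists k : R -> S, [/\ continuous k, k 0 = s0 &
    forall t, I t -> p (k t) = c t].
Proof.
move=> cc ps0.
pose A := [set u : R | exists k : R -> S, [/\ continuous k, k 0 = s0 &
  forall t, 0 <= t <= u -> p (k t) = c t]].
suff : I `<=` A.
  move=> /(_ 1)[|k [ck k0 kc]]; first by rewrite /= in_itv /= lexx ler01.
  by exists k; split=> // t; rewrite /= in_itv /=; exact: kc.
apply: (@connected_ind _ _ _ 0).
- exact: segment_connected.
- move=> u _; have [W [g [Wu [oW gK gW gloc]]]] := evenly_covered cov (c u).
  have [e e0 eW] := nbhs_ball_preimage cc oW Wu.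
  exists (ball u e); first exact: nbhsx_ballx.
  move=> y z uy uz; rewrite /= !in_itv /= => /andP[y0 _] /andP[z0 _].
  move=> [k [ck k0 kc]]; case: (leP z y) => [zy|/ltW yz].
    exists k; split=> // t /andP[t0 tz]; apply: kc.
    by rewrite t0 (le_trans tz).
  have pky : p (k y) = c y by apply: kc; rewrite y0 lexx.
  have Wky : W (p (k y)) by rewrite pky; exact: eW.
  (* Clamping keeps the added piece over [W] at all times, so the glued map is continuous on the
     whole line. *)
  have Wc t : W (c (clamp y z t)).
    apply: eW; have /andP[yt tz] := clamp_itv t yz.
    move: uy uz; rewrite /ball /= !ltr_norml; lra.
  exists (fun t => if t <= y then k t else g (k y) (c (clamp y z t))); split.
  + apply: continuous_glue => //.
      move=> t; apply: (@continuous_comp _ _ _ (c \o clamp y z) (g (k y))).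
        by apply: continuous_comp; [exact: clamp_continuous|exact: cc].
      by have [] := gW _ _ Wky (Wc t).
    by rewrite clamp_id // -pky gK.
  + by rewrite y0.
  + move=> t /andP[t0 tz]; case: ifPn => [ty|]; first by apply: kc; rewrite t0.
    rewrite -ltNge => /ltW yt.
    by have [-> _ _] := gW _ _ Wky (Wc t); rewrite clamp_id.
- by rewrite /= in_itv /= lexx ler01.
- exists (cst s0); split=> // [|t t0]; first exact: cst_continuous.
  by rewrite (_ : t = 0) //; apply: le_anti; rewrite andbC.
Qed.

(** Lift every stage of the homotopy from [m 0]. The final points form a continuous lift of a
    constant path, so they do not move: the lift of [c1] ends where [m], the lift of [c0], ends. *)
Lemma homotopy_lift (c0 c1 : R -> X) (m : R -> S) :
  path_homotopic c0 c1 -> {within I, continuous m} ->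
  (forall t, I t -> p (m t) = c0 t) ->
  exists k : R -> S, [/\ continuous k, k 0 = m 0, k 1 = m 1 &
    forall t, I t -> p (k t) = c1 t].
Proof.
move=> [H [cH H01 Hends]] cm mc0.
have cl0 : clamp 0 1 0 = 0 :> R by rewrite clamp_id.
have cl1 : clamp 0 1 1 = 1 :> R by rewrite clamp_id.
have cl : continuous (clamp 0 1 : R -> R) by exact: clamp_continuous.
pose K (t u : R) := H (clamp 0 1 t, clamp 0 1 u).
have cK : continuous (fun z : R * R => K z.1 z.2).
  apply: (continuous_within_comp
    (g := fun z : R * R => (clamp 0 1 z.1, clamp 0 1 z.2)) cH).
    apply: continuous_pair => z.
      by apply: (@continuous_comp _ _ _ fst (clamp 0 1));
          [exact: cvg_fst|exact: cl].
    by apply: (@continuous_comp _ _ _ snd (clamp 0 1));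
        [exact: cvg_snd|exact: cl].
  by move=> z; split; exact: clamp01_I.
have cK1 t : continuous (K t).
  move=> u; apply: (@continuous_comp _ _ _ (fun u => (t, u))
    (fun z : R * R => K z.1 z.2)).
    by apply: continuous_pair => ?; [exact: cvg_cst|exact: cvg_id].
  exact: cK.
have cK2 u : continuous (K ^~ u).
  move=> t; apply: (@continuous_comp _ _ _ (fun t => (t, u))
    (fun z : R * R => K z.1 z.2)).
    by apply: continuous_pair => ?; [exact: cvg_id|exact: cvg_cst].
  exact: cK.
have I0 : I 0 by rewrite /= in_itv /= lexx ler01.
have K0 t : K t 0 = c0 0 by rewrite /K cl0; have [] := Hends _ (clamp01_I t).
have K1 t : K t 1 = c0 1 by rewrite /K cl1; have [] := Hends _ (clamp01_I t).
have /choice[L LP] : forall t, exists k : R -> S,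
    [/\ continuous k, k 0 = m 0 & forall u, p (k u) = K t u].
  move=> t; have [|k [ck k0 kK]] := path_lift (s0 := m 0) (cK1 t).
    by rewrite mc0 // K0.
  exists (k \o clamp 0 1); split=> [u||u] /=.
  - by apply: continuous_comp; [exact: cl|exact: ck].
  - by rewrite cl0.
  - by rewrite kK ?/K ?(clamp01_id (clamp01_I u)) //; exact: clamp01_I.
(* Each slice [L ^~ u] is continuous: this spreads along the sheets from
   [u = 0], where the slice is constant. *)
have cL t0 u : {for t0, continuous (L ^~ u)}.
  move: u; suff : [set: R] `<=` [set u | {for t0, continuous (L ^~ u)}].
    by move=> + u; apply.
  apply: (@connected_ind _ _ _ 0) => //; [exact: connected_realT| |];
      last first.
    rewrite /= (_ : L ^~ 0 = cst (m 0)); first exact: cvg_cst.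
    by apply/funext => t; have [] := LP t.
  move=> u _; have [W [g [Wu gs]]] := evenly_covered cov (K t0 u).
  have [oW gK gW gloc] := gs.
  have : nbhs (t0, u) [set z : R * R | W (K z.1 z.2)].
    by apply: cK; exact: open_nbhs_nbhs.
  move=> /nbhs_ballP[e /= e0 eW].
  exists (ball u e); first exact: nbhsx_ballx.
  move=> y z uy uz _ _ /= cy.
  have WL t v : ball t0 e t -> ball u e v -> W (p (L t v)).
    by move=> t0t uv; have [_ _ ->] := LP t; apply: (eW (t, v)); split.
  have t00 : ball t0 e t0 by exact: ballxx.
  have conn : connected (ball u e).
    apply/connected_intervalP => a b /= ua ub v /andP[av vb]; move: ua ub.
    by rewrite /ball /= !ltr_norml; lra.
  (* Between the heights [y] and [z] the path [L t] stays in one sheet, and continuity of the slice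
     at [y] makes this sheet the same for all [t] near [t0]. *)
  have near_z : \forall t \near t0, L t z = g (L t0 y) (K t z).
    have N1 : nbhs t0 (ball t0 e) by exact: nbhsx_ballx.
    have N2 : nbhs t0 [set t | g (L t y) = g (L t0 y)].
      exact: cy _ (gloc _ (WL _ _ t00 uy)).
    apply: filterS2 N1 N2 => t t0t gy.
    have [cLt _ pL] := LP t.
    rewrite -gy -(sheet_const (C := ball u e) (f := L t) (c := z) gs)
      // -?pL ?gK //.
      exact: WL.
    by move=> v; exact: WL.
  have WK : W (K t0 z) by apply: (eW (t0, z)); split.
  have [_ _ cg] := gW _ _ (WL _ _ t00 uy) WK.
  apply: continuous_near_eq near_z _.
  by apply: (@continuous_comp _ _ _ (K ^~ z) (g (L t0 y))); [exact: cK2|].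
have e01 : L 1 1 = L 0 1.
  apply: (lift_unique (C := [set: R]) (f := L ^~ 1) (f' := cst (L 0 1))
    (c0 := 0) cov) => //.
  - exact: connected_realT.
  - by move=> t; exact: cL.
  - by move=> t; exact: cvg_cst.
  - by move=> t _ /=; have [_ _ ->] := LP t; have [_ _ ->] := LP 0; rewrite !K1.
have L0 : L 0 1 = m 1.
  rewrite -[in RHS]cl1.
  apply: (lift_unique (C := [set: R]) (f := L 0) (f' := m \o clamp 0 1)
    (c0 := 0) cov) => //.
  - exact: connected_realT.
  - by have [] := LP 0.
  - by apply: continuous_within_comp cm cl clamp01_I.
  - move=> t _ /=; have [_ _ ->] := LP 0; rewrite mc0; last exact: clamp01_I.
    by rewrite /K cl0; have [] := H01 _ (clamp01_I t).
  - by rewrite /= cl0; have [] := LP 0.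
have [cL1 L10 pL1] := LP 1.
exists (L 1); split=> //; first by rewrite e01.
by move=> t It; rewrite pL1 /K cl1 clamp01_id //; have [] := H01 _ It.
Qed.

End Lifts.

(** * Charts onto a ball, and short paths *)

Section Charts.
Set Implicit Arguments.
Unset Strict Implicit.
Context {R : realType} {X : topologicalType}.
Hypothesis surface_X : connected_surface R X.

(** An affine rescaling of a given chart. Radius 2 leaves room around the closed unit ball, whose
    image will support the pushes. *)
Lemma small_chart (x : X) (O : set X) : open O -> O x ->
  exists (U : set X) (phi : X -> 'rV[R]_2) (psi : 'rV[R]_2 -> X),
  [/\ [/\ open U, U x, U `<=` O & phi x = 0],
      forall y, U y ->
        [/\ `|phi y| < 2, psi (phi y) = y & {for y, continuous phi}] &
      forall v, `|v| < 2 ->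
        [/\ U (psi v), phi (psi v) = v & {for v, continuous psi}]].
Proof.
move=> oO Ox; have [_ _ _ _ /(_ x)[U [V [phi [oU Ux oV]]]]] := surface_X.
move=> [psi [cphi cpsi phiU psiV psiK]].
have {}cphi y : U y -> {for y, continuous phi}.
  by move=> Uy; move: cphi;
      rewrite continuous_open_subspace // => /(_ y (mem_set Uy)).
have {}cpsi v : V v -> {for v, continuous psi}.
  by move=> Vv; move: cpsi;
      rewrite continuous_open_subspace // => /(_ v (mem_set Vv)).
have Vphi y : U y -> V (phi y) by rewrite -phiU; exists y.
have Upsi v : V v -> U (psi v) by rewrite -psiV; exists v.
have phiK v : V v -> phi (psi v) = v by rewrite -phiU => -[y Uy <-];
    rewrite psiK.
have : nbhs (phi x) (V `&` psi @^-1` O).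
  apply: filterI; first by apply: open_nbhs_nbhs; split=> //; exact: Vphi.
  by apply: (cpsi _ (Vphi _ Ux)); apply: open_nbhs_nbhs; rewrite psiK.
move=> /nbhs_ballP[r /= r0 rVO].
have inball v : `|v| < 2 -> ball (phi x) r (phi x + (r / 2) *: v).
  move=> v2; rewrite -ball_normE /= opprD addNKr normrN normrZ gtr0_norm
      ?divr_gt0 //.
  by nra.
pose phi' y := (2 / r) *: (phi y - phi x).
pose psi' v := psi (phi x + (r / 2) *: v).
have cphi' y : U y -> {for y, continuous phi'}.
  move=> Uy; apply: cvgZr; apply: cvgB; [exact: cphi|exact: cvg_cst].
have rn0 : r != 0 by exact: lt0r_neq0.
have rr : 2 / r * (r / 2) = 1 by field.
have rr' : r / 2 * (2 / r) = 1 by rewrite mulrC.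
exists (U `&` O `&` phi' @^-1` [set v | `|v| < 2]), phi', psi'; split.
- split=> [| | |].
  + rewrite openE => y [[Uy Oy] y2]; apply: filterI.
      by apply: filterI; exact: open_nbhs_nbhs.
    exact: (cvgr_norm_lt _ (cphi' _ Uy)).
  + by split=> //=; rewrite /phi' subrr scaler0 normr0.
  + by move=> y [[]].
  + by rewrite /phi' subrr scaler0.
- move=> y [[Uy Oy] y2]; split=> //; last exact: cphi'.
  by rewrite /psi' /phi' scalerA rr' scale1r addrC subrK psiK.
- move=> v v2; have [Vv Ov] := rVO _ (inball _ v2).
  have E : phi' (psi' v) = v by rewrite /phi' /psi' phiK //
      addrAC subrr add0r scalerA rr scale1r.
  split=> //; first by split; [split=> //; exact: Upsi|rewrite /= E].
  rewrite (_ : psi' = psi \o (fun v => phi x + (r / 2) *: v)) //.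
  apply: continuous_comp; last exact: cpsi.
  apply: (@continuousD _ _ _ (cst _) (fun v => (r / 2) *: v)).
    exact: cst_continuous.
  by apply: continuousZr; exact: cvg_id.
Qed.

(** The ball is convex, so segments in the chart give the paths. *)
Lemma local_paths (x : X) (O : set X) : open O -> O x ->
  exists2 N, nbhs x N & forall a b, N a -> N b -> exists c : R -> X,
    [/\ continuous c, c 0 = a, c 1 = b & forall t, O (c t)].
Proof.
move=> oO Ox; have [U [phi [psi [[oU Ux UO _] phiP psiP]]]] :=
    small_chart oO Ox.
exists U; first exact: open_nbhs_nbhs.
move=> a b Ua Ub; pose l (t : R) :=
    (1 - clamp 0 1 t) *: phi a + clamp 0 1 t *: phi b.
have l2 t : `|l t| < 2.
  have [a2 _ _] := phiP _ Ua; have [b2 _ _] := phiP _ Ub.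
  have /andP[t0 t1] := clamp_itv t (@ler01 R).
  apply: le_lt_trans (ler_normD _ _) _; rewrite !normrZ !ger0_norm ?subr_ge0 //.
  by have [] := lerP (`|phi a|) (`|phi b|); nra.
have cl : continuous l.
  have cc := clamp_continuous (@ler01 R).
  move=> t; apply: cvgD; apply: cvgZl; last exact: cc.
  by apply: cvgB; [exact: cvg_cst|exact: cc].
exists (psi \o l); split=> [t| | |t].
- by apply: continuous_comp; [exact: cl|have [] := psiP _ (l2 t)].
- by rewrite /= /l clamp_id // subr0 scale1r scale0r addr0;
    have [] := phiP _ Ua.
- by rewrite /= /l clamp_id // subrr scale1r scale0r add0r;
    have [] := phiP _ Ub.
- by apply: UO; have [] := psiP _ (l2 t).
Qed.

End Charts.

(** * The lifting criterion for a homeomorphism fixing the base point *)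

Section Tracks.
Set Implicit Arguments.
Unset Strict Implicit.
Context {R : realType} {S X : topologicalType} (p : S -> X).
Hypothesis surface_S : connected_surface R S.
Hypothesis cov : covering_map p.
Local Notation I := (`[0 : R, 1]%classic).

Lemma continuous_path_cat {T : topologicalType} (c d : R -> T) :
  continuous c -> continuous d -> c 1 = d 0 -> continuous (path_cat c d).
Proof.
move=> cc cd cd0.
have c2 : continuous (fun t : R => 2 * t).
  by move=> t; apply: cvgM; [exact: cvg_cst|exact: cvg_id].
apply: (continuous_glue (a := 2^-1)
  (f := fun t => c (2 * t)) (g := fun t => d (2 * t - 1))).
- by move=> t; apply: (@continuous_comp _ _ _ (fun t : R => 2 * t) c);
    [exact: c2|exact: cc].
- move=> t; apply: (@continuous_comp _ _ _ (fun t : R => 2 * t - 1) d);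
    last exact: cd.
  by apply: cvgB; [exact: c2|exact: cvg_cst].
- by rewrite divff ?pnatr_eq0 // subrr.
Qed.

Lemma path_cat0 {T : topologicalType} (c d : R -> T) : path_cat c d 0 = c 0.
Proof. by rewrite /path_cat invr_ge0 ler0n mulr0. Qed.

Lemma path_cat1 {T : topologicalType} (c d : R -> T) : path_cat c d 1 = d 1.
Proof.
rewrite /path_cat; case: lerP => [h|_]; first by exfalso; lra.
by congr d; lra.
Qed.

Lemma path_homotopic_refl {T : topologicalType} (c : R -> T) :
  continuous c -> path_homotopic c c.
Proof.
move=> cc; exists (c \o snd); split=> //; apply: continuous_subspaceT => z.
by apply: continuous_comp; [exact: cvg_snd|exact: cc].
Qed.

(* [b] is the value at [a] of the lift of [h] fixing [s]: it ends the lift [e]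
   of the image under [h \o p] of a path [d] from [s] to [a]. *)
Definition tracked (h : X -> X) (s a b : S) : Prop :=
  exists d e : R -> S, [/\ continuous d, continuous e, d 0 = s /\ e 0 = s,
    d 1 = a /\ e 1 = b & forall t, h (p (d t)) = p (e t)].

Lemma tracked_inv (h : Homeo X) s a b :
  tracked h s a b -> tracked (h^-1)%g s b a.
Proof.
move=> [d [e [cd ce [d0 e0] [d1 e1] hde]]]; exists e, d; split=> // t.
by rewrite -hde homeoK.
Qed.

(** Follow [d] and return along [d']: this loop [l] projects into the subgroup of the covering. By
    invariance [h \o p \o l] is homotopic to the projection of a loop at [s], so it has a closed
    lift [k] at [s]. The first half of [k] is [e] and its reversed second half is [e'], so [b] and
    [b'] are both the midpoint of [k]. *)
Lemma tracked_unique (h : Homeo X) s a b b' : h (p s) = p s ->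
  (forall c : R -> X, pi1_image p s c -> pi1_image p s (h \o c)) ->
  tracked h s a b -> tracked h s a b' -> b = b'.
Proof.
move=> hs hinv [d [e [cd ce [d0 e0] [d1 e1] hde]]].
move=> [d' [e' [cd' ce' [d'0 e'0] [d'1 e'1] hde']]].
have cp := covering_continuous cov.
pose l := path_cat d (path_rev d').
have cl : continuous l.
  apply: continuous_path_cat => //; last by rewrite /path_rev subr0 d1.
  move=> t; apply: (@continuous_comp _ _ _ (fun t : R => 1 - t) d');
      last exact: cd'.
  by apply: cvgB; [exact: cvg_cst|exact: cvg_id].
have l0 : l 0 = s by rewrite /l path_cat0.
have l1 : l 1 = s by rewrite /l path_cat1 /path_rev subrr.
have cpl : continuous (p \o l) by move=> t; apply: continuous_comp;
    [exact: cl|exact: cp].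
have : pi1_image (R := R) p s (p \o l).
  split; first by split;
      [exact: continuous_subspaceT|rewrite /= l0|rewrite /= l1].
  exists l; last exact: path_homotopic_refl.
  by split=> //; exact: continuous_subspaceT.
move=> /hinv[_ [m [cm m0 m1] mhom]].
have [//|k [ck k0 k1 pk]] := homotopy_lift cov mhom cm.
have I0 : I 0 by rewrite /= in_itv /= lexx ler01.
have I1 : I 1 by rewrite /= in_itv /= lexx ler01.
have cI : connected I by exact: segment_connected.
have halfI t : I t -> I (t / 2) /\ I (1 - t / 2).
  by rewrite /= !in_itv /=; lra.
have l_half (t : R) : I t -> l (t / 2) = d t.
  rewrite /= in_itv /= /l /path_cat => /andP[_ t1].
  have -> : t / 2 <= 2^-1 by lra.
  by congr d; lra.
have l_half' (t : R) : I t -> l (1 - t / 2) = d' t.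
  rewrite /= in_itv /= /l /path_cat /path_rev => /andP[_ t1].
  (* At the midpoint, reached for [t = 1], [path_cat] takes its first branch [d]; there [d] and [d']
     agree, since both end at [a]. *)
  case: lerP => [th|_]; last by congr d'; lra.
  have -> : t = 1 by lra.
  have -> : 2 * (1 - 1 / 2) = 1 :> R by lra.
  by rewrite d1 d'1.
have chalf : continuous (fun t : R => t / 2).
  by move=> t; apply: cvgM; [exact: cvg_id|exact: cvg_cst].
have ke : k (1 / 2) = b.
  rewrite -e1.
  apply: (lift_unique cov (C := I) (f := fun t => k (t / 2)) (f' := e)
    (c0 := 0)) => //.
  - by move=> t; apply: (@continuous_comp _ _ _ (fun t : R => t / 2) k);
      [exact: chalf|exact: ck].
  - move=> t It; rewrite pk; last by case: (halfI _ It).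
    by rewrite -hde /= l_half.
  - by rewrite mul0r k0 m0.
have ke' : k (1 / 2) = b'.
  rewrite -e'1 (_ : 1 / 2 = 1 - 1 / 2 :> R); last by lra.
  apply: (lift_unique cov (C := I) (f := fun t => k (1 - t / 2))
    (f' := e') (c0 := 0)) => //.
  - move=> t; apply: (@continuous_comp _ _ _ (fun t : R => 1 - t / 2) k);
      last exact: ck.
    by apply: cvgB; [exact: cvg_cst|exact: chalf].
  - move=> t It; rewrite pk; last by case: (halfI _ It).
    by rewrite -hde' /= l_half'.
  - by rewrite mul0r subr0 k1 m1.
by rewrite -ke.
Qed.

(** Append to [d] a short path from [a] to [a'], and to [e] the lift of its image through the sheet
    of [b]. The new endpoint is then a continuous function of [a']. As [N] depends only on [a0], the
    lemma serves both existence and continuity of the lift. *)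
Lemma tracked_extend (h : Homeo X) s a0 :
  exists2 N, nbhs a0 N & forall a b, N a -> tracked h s a b ->
    exists2 q : S -> S, {for a0, continuous q} &
      forall a', N a' -> tracked h s a' (q a').
Proof.
have cp := covering_continuous cov.
have chp : continuous (h \o p).
  by move=> a; apply: continuous_comp; [exact: cp|exact: homeo_continuous].
have [W [g [Wa0 [oW gK gW _]]]] := evenly_covered cov (h (p a0)).
have oO : open ((h \o p) @^-1` W) by apply: open_comp => // a _; exact: chp.
have [N aN Npath] := local_paths surface_S oO Wa0.
exists N => // a b Na [d [e [cd ce [d0 e0] [d1 e1] hde]]].
have pb : p b = h (p a) by rewrite -d1 -e1 hde.
(* [N] is known only through its paths; the one joining [a] to itself shows that [h (p a)] lies in
   [W]. *)
have Wpb : W (p b).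
  by have [c [_ c0 _ /(_ 0)]] := Npath a a Na Na; rewrite /= c0 -pb.
exists (g b \o h \o p).
  by apply: (@continuous_comp _ _ _ (h \o p) (g b));
      [exact: chp|have [] := gW _ _ Wpb Wa0].
move=> a' Na'; have [c [cc c0 c1 Oc]] := Npath _ _ Na Na'.
exists (path_cat d c), (path_cat e (g b \o h \o p \o c)); split.
- by apply: continuous_path_cat => //; rewrite d1.
- apply: continuous_path_cat => //; last by rewrite e1 /= c0 -pb gK.
  move=> t; apply: (@continuous_comp _ _ _ (h \o p \o c) (g b)).
    by apply: (@continuous_comp _ _ _ c (h \o p)); [exact: cc|exact: chp].
  by have [] := gW _ _ Wpb (Oc t).
- by rewrite !path_cat0.
- by rewrite !path_cat1 /= c1.
- move=> t; rewrite /path_cat; case: ifP => // _ /=.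
  by have [-> _ _] := gW _ _ Wpb (Oc (2 * t - 1)).
Qed.

(** Existence of a tracked value spreads from [s] over the connected space [S]; uniqueness
    identifies the chosen function near each point with the continuous [q] of [tracked_extend]. *)
Lemma tracked_lift (h : Homeo X) s : h (p s) = p s ->
  (forall c : R -> X, pi1_image p s c -> pi1_image p s (h \o c)) ->
  exists2 f : S -> S, continuous f & forall a, tracked h s a (f a).
Proof.
move=> hs hinv.
have /choice[f fP] : forall a, exists b, tracked h s a b.
  suff : [set: S] `<=` [set a | exists b, tracked h s a b] by move=> + a; apply.
  apply: (@connected_ind _ _ _ s) => //; first by case: surface_S.
    move=> a0 _; have [N aN Next] := tracked_extend h s a0.
    exists N => // y z Ny Nz _ _ /= [b /(Next _ _ Ny)[q _ qP]].
    by exists (q z); exact: qP.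
  by exists s, (cst s), (cst s); split=> // t; exact: cvg_cst.
exists f => // a0; have [N aN Next] := tracked_extend h s a0.
have [q cq qP] := Next _ _ (nbhs_singleton aN) (fP a0).
apply: continuous_near_eq cq; apply: filterS aN => a Na.
exact: tracked_unique hs hinv (fP a) (qP _ Na).
Qed.

Lemma induces_fiber_preserving (f : Homeo S) (h : Homeo X) :
  induces p f h -> fiber_preserving p f.
Proof.
move=> fh x; exists (h x); apply/seteqP; split=> [_ [s /= <- <-]|s /= ps].
  by rewrite -fh.
exists (f^-1%g s); last exact: homeoKV.
by rewrite /= -(inducesV fh) ps homeoK.
Qed.

(** Lift [h] and its inverse at [s]. Exchanging the two paths of a track turns one lift into the
    other, so by uniqueness they are mutually inverse. *)
Lemma liftable_fixing (h : Homeo X) s : h (p s) = p s ->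
  invariant_under_geometric_automorphisms (p s) (pi1_image (R := R) p s) ->
  liftable p h.
Proof.
move=> hs inv.
have hVs : (h^-1)%g (p s) = p s by rewrite -[in LHS]hs homeoK.
have [f cf fP] := tracked_lift hs (inv h hs).
have [f' cf' f'P] := tracked_lift hVs (inv _ hVs).
have fK : cancel f f'.
  move=> a; apply: tracked_unique hVs (inv _ hVs) (f'P _) _.
  exact/tracked_inv.
have f'K : cancel f' f.
  move=> a; apply: tracked_unique hs (inv _ hs) (fP _) _.
  by rewrite -[h]invgK; exact/tracked_inv.
have fH : `[< homeomorphism f >] by apply/asboolP; exists f'.
have fh : induces p (MkHomeo fH) h.
  by move=> a /=; have [d [e [_ _ _ [<- <-] ->]]] := fP a.
by exists (MkHomeo fH) => //; exact: induces_fiber_preserving fh.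
Qed.

End Tracks.

(** * Homeomorphisms moving the centre of the unit ball *)

Section Push.
Set Implicit Arguments.
Unset Strict Implicit.
Context {R : realType} {V : normedModType R}.
Implicit Types v w : V.

(** Vanishing outside the unit ball, the weight lets a single formula describe [push] both inside
    and outside, which makes continuity across the sphere immediate. *)
Definition push_weight w : R := clamp 0 1 (1 - `|w|).

(* Conjugated by [w |-> (1 - |w|)^-1 *: w], which maps the open unit ball onto
   [V], this is the translation by [v]; it extends by the identity. *)
Definition push v w : V :=
  ((`|w| + push_weight w) / (push_weight w + `|w + push_weight w *: v|)) *:
  (w + push_weight w *: v).

Lemma push_weight_out w : 1 <= `|w| -> push_weight w = 0.
Proof. by rewrite /push_weight /clamp subr_le0 => ->. Qed.

Lemma push_weight_in w : `|w| < 1 -> push_weight w = 1 - `|w|.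
Proof.
by move=> w1; rewrite /push_weight clamp_id ?subr_ge0 ?(ltW w1) //
    lerBlDr lerDl.
Qed.

Lemma push_den_gt0 v w : 0 < push_weight w + `|w + push_weight w *: v|.
Proof.
have [w1|w1] := ltP `|w| 1.
  by rewrite ltr_wpDr // push_weight_in // subr_gt0.
by rewrite push_weight_out // add0r scale0r addr0 (lt_le_trans ltr01).
Qed.

Lemma push_out v w : 1 <= `|w| -> push v w = w.
Proof.
move=> w1; rewrite /push push_weight_out //
    scale0r !addr0 add0r divff ?scale1r //.
by rewrite gt_eqF // (lt_le_trans ltr01).
Qed.

Lemma push0 v : push v 0 = (1 + `|v|)^-1 *: v.
Proof.
by rewrite /push push_weight_in normr0 // subr0 !add0r !scale1r mul1r.
Qed.

Lemma norm_push_lt1 v w : `|w| < 1 -> `|push v w| < 1.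
Proof.
move=> w1; rewrite /push push_weight_in // addrC subrK normrZ mul1r.
have := push_den_gt0 v w; rewrite push_weight_in // => D0.
by rewrite gtr0_norm ?invr_gt0 // mulrC ltr_pdivrMr // mul1r ltrDr subr_gt0.
Qed.

Lemma pushK v : cancel (push v) (push (- v)).
Proof.
move=> w; have [w1|w1] := ltP `|w| 1; last by rewrite !push_out.
have pw1 := norm_push_lt1 v w1.
rewrite {1}/push (push_weight_in pw1).
have D0 := push_den_gt0 v w; rewrite (push_weight_in w1) in D0.
move: pw1; rewrite /push (push_weight_in w1) (addrC `|w|) subrK mul1r.
(* The image of [w] is [u / D], of weight [(1 - |w|) / D]. Subtracting this multiple of [v] gives
   [w / D], and the new denominator is [1 / D], which restores [w]. *)
set u := w + _ in D0 *; set D := (1 - `|w| + `|u|) in D0 *.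
have Dn0 : D != 0 by rewrite gt_eqF.
have nE : `|D^-1 *: u| = `|u| / D by rewrite normrZ gtr0_norm ?invr_gt0 //
    mulrC.
rewrite nE => _.
have mE : 1 - `|u| / D = (1 - `|w|) / D.
  by rewrite -[X in X - _](divff Dn0) -mulrBl /D addrK.
rewrite (addrC (`|u| / D)) subrK mE.
have uE : D^-1 *: u + ((1 - `|w|) / D) *: - v = D^-1 *: w.
  by rewrite mulrC -scalerA -scalerDr scalerN /u addrK.
rewrite uE normrZ gtr0_norm ?invr_gt0 //
    (mulrC _ `|w|) -mulrDl subrK !mul1r invrK.
by rewrite scalerA divff // scale1r.
Qed.

Lemma push_continuous v : continuous (push v).
Proof.
have cm : continuous push_weight.
  move=> w; apply: (@continuous_comp _ _ _ (fun w => 1 - `|w|) (clamp 0 1)).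
    by apply: cvgB; [exact: cvg_cst|exact: norm_continuous].
  exact: clamp_continuous.
have cu : continuous (fun w => w + push_weight w *: v).
  by move=> w; apply: cvgD; [exact: cvg_id|apply: cvgZl; exact: cm].
move=> w; apply: cvgZ; last exact: cu.
apply: cvgM; first by apply: cvgD; [exact: norm_continuous|exact: cm].
apply: cvgV; first by rewrite gt_eqF // push_den_gt0.
by apply: cvgD; [exact: cm|apply: cvg_norm; exact: cu].
Qed.

(** By [push0] this inverts the radial map from [V] to the open unit ball that divides a vector by 1
    plus its norm. *)
Lemma push_surj v : `|v| < 1 -> exists v', push v' 0 = v.
Proof.
move=> v1; have d0 : 0 < 1 - `|v| by rewrite subr_gt0.
exists ((1 - `|v|)^-1 *: v);
    rewrite push0 normrZ gtr0_norm ?invr_gt0 // scalerA.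
rewrite -invfM mulrDl mul1r mulrC mulrA divff ?gt_eqF //
    mul1r subrK invr1 scale1r //.
Qed.

End Push.

(** * Transitivity of the liftable homeomorphisms *)

Section Homogeneity.
Set Implicit Arguments.
Unset Strict Implicit.
Context {R : realType} {S X : topologicalType} (p : S -> X).
Hypothesis surface_X : connected_surface R X.
Hypothesis cov : covering_map p.

Lemma compact_unit_ball n : compact [set v : 'rV[R]_n | `|v| <= 1].
Proof.
apply: bounded_closed_compact.
  exists 1; split; first exact: num_real.
  by move=> M M1 v /= v1; apply: le_trans v1 (ltW M1).
apply: (@preimage_closed _ _ (fun v : 'rV[R]_n => `|v|) [set r | r <= 1]).
  by move=> v _; exact: norm_continuous.
exact: closed_le.
Qed.

(** Conjugate [push] by a chart centred at [x] and extend by the identity. The support [D] is the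
    image of the closed unit ball: compact, hence closed as [X] is Hausdorff, and the same for all
    targets [y]. *)
Lemma supported_push (x : X) (W : set X) : open W -> W x ->
  exists2 D, closed D /\ D `<=` W &
    \forall y \near x, exists2 h : Homeo X, h x = y &
      forall z, ~ D z -> h z = z.
Proof.
move=> oW Wx; have [U [phi [psi [[oU Ux UW phix] phiP psiP]]]] :=
    small_chart surface_X oW Wx.
have lt12 : 1 < 2 :> R by rewrite ltr1n.
pose B := [set v : 'rV[R]_2 | `|v| <= 1].
have B2 v : B v -> `|v| < 2 by move=> /le_lt_trans; apply.
pose D := psi @` B.
have cD : closed D.
  have [_ _ hX _ _] := surface_X.
  apply: compact_closed hX _; apply: continuous_compact;
      last exact: compact_unit_ball.
  apply: continuous_in_subspaceT => v /set_mem Bv.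
  by have [] := psiP _ (B2 _ Bv).
have DU : D `<=` U by move=> _ [v /B2 v2 <-]; have [] := psiP _ v2.
have push2 (v w : 'rV[R]_2) : `|w| < 2 -> `|push v w| < 2.
  move=> w2; have [w1|w1] := ltP `|w| 1; last by rewrite push_out.
  by apply: lt_trans lt12; exact: norm_push_lt1.
pose h v z := if pselect (U z) then psi (push v (phi z)) else z.
have hU v z : U z -> h v z = psi (push v (phi z)) by rewrite /h; case: pselect.
have hN v z : ~ U z -> h v z = z by rewrite /h; case: pselect.
have hK v : cancel (h v) (h (- v)).
  move=> z; have [Uz|nUz] := pselect (U z); last by rewrite !hN.
  have [z2 zK _] := phiP _ Uz; have [Uh hE _] := psiP _ (push2 v _ z2).
  by rewrite (hU v) // hU // hE pushK zK.
have hout v z : ~ D z -> h v z = z.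
  have [Uz nDz|/hN//] := pselect (U z); have [_ zK _] := phiP _ Uz.
  rewrite hU // push_out //; apply: contrapT => /negP; rewrite -ltNge => z1.
  by apply: nDz; exists (phi z) => //; exact: ltW.
have ch v : continuous (h v).
  apply: (continuous_supported oU cD DU) (hout v) => z Uz.
  have [z2 _ cz] := phiP _ Uz; have [_ _ cpsi] := psiP _ (push2 v _ z2).
  apply: (@continuous_near_eq _ _ (psi \o (push v \o phi))).
    have : nbhs z U by exact: open_nbhs_nbhs.
    by apply: filterS => y; exact: hU.
  apply: continuous_comp; last exact: cpsi.
  by apply: continuous_comp; [exact: cz|exact: push_continuous].
exists D; first by split=> // z /DU; exact: UW.
have Ny : nbhs x [set y | `|phi y| < 1].
  by have [_ _ cx] := phiP _ Ux; apply: cvgr_norm_lt cx _ _;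
      rewrite phix normr0.
have NU : nbhs x U by exact: open_nbhs_nbhs.
apply: filterS2 Ny NU => y /= y1 Uy; have [v vE] := push_surj y1.
have hH : `[< homeomorphism (h v) >].
  apply/asboolP; exists (h (- v)); split=> //.
  by rewrite -[X in cancel _ (h X)]opprK.
exists (MkHomeo hH) => /=; last exact: hout.
by rewrite hU // phix vE; have [] := phiP _ Uy.
Qed.

(** Apply [h] separately in each sheet over [W] and the identity elsewhere; the two agree off the
    preimage of [D]. The same recipe for the inverse of [h] gives the inverse lift. *)
Lemma liftable_supported (h : Homeo X) (D W : set X) (g : S -> X -> S) :
  sheet_sections p W g -> closed D -> D `<=` W ->
  (forall z, ~ D z -> h z = z) -> liftable p h.
Proof.
move=> [oW gK gW gloc] cD DW hD; have cp := covering_continuous cov.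
(* If [k z] left [W] it would be fixed by [k], and injectivity would give [k z = z]. *)
have hW (k : Homeo X) z : (forall z, ~ D z -> k z = z) -> W z -> W (k z).
  move=> kD Wz; apply: contrapT => nWk.
  have : k (k z) = k z by apply: kD => /DW.
  by move=> /(can_inj (homeoK k)) E; apply: nWk; rewrite E.
pose F (k : Homeo X) s := if pselect (W (p s)) then g s (k (p s)) else s.
have FW k s : W (p s) -> F k s = g s (k (p s)) by rewrite /F; case: pselect.
have FN k s : ~ W (p s) -> F k s = s by rewrite /F; case: pselect.
pose supp (k : Homeo X) := forall z, ~ D z -> k z = z.
have Fout k s : supp k -> ~ D (p s) -> F k s = s.
  move=> kD Ds; have [Ws|/FN//] := pselect (W (p s)).
  by rewrite FW // kD // gK.
have cF k : supp k -> continuous (F k).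
  move=> kD; apply: (@continuous_supported _ _ (p @^-1` W) (p @^-1` D)).
  - by apply: open_comp => // ? _; exact: cp.
  - by apply: preimage_closed => // ? _; exact: cp.
  - by move=> s /DW.
  - move=> s Ws; apply: (@continuous_near_eq _ _ (g s \o (k \o p))).
      have NW : nbhs s (p @^-1` W) by apply: cp; exact: open_nbhs_nbhs.
      by apply: filterS2 NW (gloc _ Ws) => s' Ws' gE; rewrite FW // gE.
    apply: continuous_comp; last by have [] := gW _ _ Ws (hW _ _ kD Ws).
    by apply: continuous_comp; [exact: cp|exact: homeo_continuous].
  - by move=> s; exact: Fout.
have FK k : supp k -> cancel (F k) (F (k^-1)%g).
  move=> kD s; have [Ws|nWs] := pselect (W (p s)); last by rewrite !FN.
  have [pg gg _] := gW _ _ Ws (hW _ _ kD Ws).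
  by rewrite (FW k) // FW pg ?gg ?homeoK ?gK //; exact: hW.
have hV : supp (h^-1)%g by move=> z /hD zE; rewrite -[in LHS]zE homeoK.
have fH : `[< homeomorphism (F h) >].
  apply/asboolP; exists (F (h^-1)%g); split; [exact: cF|exact: cF|exact: FK|].
  by rewrite -[X in cancel _ (F X)]invgK; exact: FK.
have fh : induces p (MkHomeo fH) h.
  move=> s /=; have [Ws|nWs] := pselect (W (p s)).
    by have [] := gW _ _ Ws (hW _ _ hD Ws); rewrite FW.
  by rewrite FN // hD // => /DW.
by exists (MkHomeo fH) => //; exact: induces_fiber_preserving fh.
Qed.

Lemma liftableM (h k : Homeo X) :
  liftable p h -> liftable p k -> liftable p (h * k)%g.
Proof.
move=> [f fp fh] [f' fp' fh']; exists (f * f')%g.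
  exact: fiber_preservingM.
exact: inducesM.
Qed.

Lemma liftableV (h : Homeo X) : liftable p h -> liftable p (h^-1)%g.
Proof.
by move=> [f fp fh]; exists (f^-1)%g;
    [exact: fiber_preservingV|exact: inducesV].
Qed.

(** Supported pushes make the orbit of [z] a neighbourhood of [z]. Orbits are thus open, and
    connectedness leaves only one. *)
Lemma liftable_transitive (x y : X) :
  exists2 h : Homeo X, liftable p h & h x = y.
Proof.
suff : [set: X] `<=` [set y | exists2 h : Homeo X, liftable p h & h x = y].
  by move=> /(_ y); apply.
apply: (@connected_ind _ _ _ x) => //; first by case: surface_X.
  move=> z _; have [W [g [Wz gs]]] := evenly_covered cov z.
  have [oW _ _ _] := gs; have [D [cD DW] near_z] := supported_push oW Wz.
  have lift_z : \forall y \near z, exists2 h : Homeo X, liftable p h & h z = y.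
    apply: filterS near_z => y' [h hz hD].
    by exists h => //; exact: liftable_supported gs cD DW hD.
  exists [set y | exists2 h : Homeo X, liftable p h & h z = y] => //.
  move=> y1 y2 [h1 l1 <-] [h2 l2 <-] _ _ [k lk kx].
  (* The point [x] travels to [y1], then to [z], then to [y2]. *)
  exists (h2 * (h1^-1 * k))%g.
    by apply: liftableM l2 _; apply: liftableM lk; exact: liftableV.
  by rewrite !homeoME kx homeoK.
exists 1%g => //; exists 1%g; [exact: fiber_preserving1|exact: induces1].
Qed.

End Homogeneity.

(** * Liftability of every homeomorphism *)

Section Liftable.
Set Implicit Arguments.
Unset Strict Implicit.
Context {R : realType} {S X : topologicalType} (p : S -> X).

Lemma characteristic_liftable :
  connected_surface R S -> connected_surface R X ->
  covering_map p -> geometrically_characteristic R p ->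
  forall h : Homeo X, liftable p h.
Proof.
move=> sS sX cov [s inv] h.
have [g lg ghs] := liftable_transitive sX cov (h (p s)) (p s).
(* Write [h] as the inverse of [g] times [g * h], where [g * h] fixes [p s]. *)
rewrite -[h](mulKg g); apply: liftableM; first exact: liftableV.
by apply: (liftable_fixing sS cov _ inv); rewrite homeoME.
Qed.

End Liftable.

(** * From a splitting to a lifting homomorphism *)

Section Final.
Set Implicit Arguments.
Unset Strict Implicit.
Context (R : realType) (S X : topologicalType) (p : S -> X) (P : set X).

Lemma proj_section_lifts (s : LMap R p P -> SMap R p P) :
  s 1%g = 1%g -> cancel s (@smap_proj R S X p P) ->
  forall c, lifts (s c) c.
Proof.
(* If no class is a projection of [s c], then [smap_proj (s c)] is the default
   value 1, hence [c = 1] and the identity of [S] lifts it. *)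
move=> s1 sK c; have := sK c; rewrite /smap_proj.
case: xgetP => [d _ cd E|_ <-]; first by rewrite E in cd.
rewrite s1; exists 1%g, 1%g; split=> //.
exact: fiber_preserving1.
Qed.

(** Once all homeomorphisms lift, [LMap] is the whole of [Map R P]. The section followed by the
    inclusion of [SMap] is then the homomorphism sought, injective because the section has a left
    inverse. *)
Lemma splitting_lifts_Map :
  exact_sequence_splits R p P ->
  (forall h : Homeo X, liftable p h) ->
  exists Phi : {multiplicative Map R P -> Map R (p @^-1` P)},
    injective Phi /\ forall c : Map R P, lifts (Phi c) c.
Proof.
move=> [s sK] lift.
have inL (c : Map R P) : c \in lmap_pred p (P := P).
  by apply/asboolP; have [f ->] := mclass_ex c; exists f.
pose toL (c : Map R P) : LMap R p P := MkLMap (inL c).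
have toLM c d : toL (c * d)%g = (toL c * toL d)%g by exact: val_inj.
pose F (c : Map R P) : Map R (p @^-1` P) := val (s (toL c)).
have FM : {morph F : c d / (c * d)%g}.
  by move=> c d; rewrite /F toLM gmulfM.
have F1 : F 1%g = 1%g by apply: (mulgI (F 1%g)); rewrite -FM !mulg1.
pose Phi : {multiplicative Map R P -> Map R (p @^-1` P)} :=
  HB.pack F (isMultiplicative.Build _ _ F FM).
exists Phi; split.
  by move=> c d /val_inj/(can_inj sK)/(congr1 val).
move=> c; apply: (proj_section_lifts _ sK (toL c)).
by apply: (mulgI (s 1%g)); rewrite -gmulfM !mulg1.
Qed.
End Final.

Theorem proposition5p3 (R : realType) (S X : topologicalType) (p : S -> X)
    (P : set X)
    (surface_S : connected_surface R S) (surface_X : connected_surface R X)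
    (covering_p : covering_map p)
    (characteristic_p : geometrically_characteristic R p)
    (closed_discrete_P : closed_discrete P)
    (type_S : infinite_type R S \/
              (finite_type R S /\
               exists e : int, euler_characteristic R S e /\ e < 0))
    (splits : exact_sequence_splits R p P) :
  exists Phi : {multiplicative Map R P -> Map R (p @^-1` P)},
    injective Phi /\ forall c : Map R P, lifts (Phi c) c.
Proof.
apply: (splitting_lifts_Map splits).
exact: characteristic_liftable surface_S surface_X covering_p characteristic_p.
Qed.
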